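(* Let $F$ be an absolute, normalised norm on $\mathbb{R}^2$ such that $(0,1)$ is an extreme point of the closed unit ball of $(\mathbb{R}^2,F^* )$, where $F^*$ is the reversed dual norm of $F$. If $X$ is a GL-space and $Y$ is an $F$-ideal in $X$, then $Y$ is also a GL-space.
   Context: All Banach spaces are real. For a Banach space $X$, $B_X$ is the closed unit ball, $S_X$ the unit sphere, $X^*$ the dual. For $x^*\in S_{X^*}$ and $\varepsilon>0$ put $S(x^*,\varepsilon)=\{x\in B_X: x^*(x)>1-\varepsilon\}$, and $-S(x^*,\varepsilon)=\{-x: x\in S(x^*,\varepsilon)\}$. For $A\subseteq X$, $\operatorname{d}(x,A)$ is the distance from $x$ to $A$. $X$ is called a generalised lush (GL) space if for every $x\in S_X$ and every $\varepsilon>0$ there is $x^*\in S_{X^*}$ such that $x\in S(x^*,\varepsilon)$ and $\operatorname{d}(y,S(x^*,\varepsilon))+\operatorname{d}(y,-S(x^*,\varepsilon))<2+\varepsilon$ for all $y\in S_X$. A norm $F$ on $\mathbb{R}^2$ is absolute if $F(a,b)=F(|a|,|b|)$ for all $(a,b)\in\mathbb{R}^2$, and normalised if $F(1,0)=1=F(0,1)$. The reversed dual norm of $F$ is $F^*(a,b)=\sup\{|av+bu|:(u,v)\in\mathbb{R}^2,\ F(u,v)\le 1\}$; it is again absolute and normalised. For an absolute, normalised norm $G$ on $\mathbb{R}^2$, a linear projection $P:X\to X$ is a $G$-projection if $\|x\|=G(\|Px\|,\|x-Px\|)$ for all $x\in X$. A closed subspace of $X$ is a $G$-summand in $X$ if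 it is the range of a $G$-projection on $X$. A closed subspace $Y$ of $X$ is an $F$-ideal in $X$ if its annihilator $Y^\perp=\{x^*\in X^*: x^*|_Y=0\}$ is an $F^*$-summand in $X^*$. (For $F$ the maximum norm, the $F$-ideals are exactly the $M$-ideals.) *)

(* Defs.v *)
From HB Require Import structures.
From mathcomp Require Import all_boot all_order all_algebra.
From mathcomp Require Import all_classical all_reals all_analysis.

Set Implicit Arguments.
Unset Strict Implicit.
Unset Printing Implicit Defensive.

Import Order.TTheory GRing.Theory Num.Theory.
Import numFieldNormedType.Exports.

Local Open Scope classical_set_scope.
Local Open Scope ring_scope.

Section Dual.
Context {R : realType} (X : normedModType R).

Definition dual_pred : {pred X -> R^o} :=
  fun f => `[< linear f /\ continuous f >].

Lemma dual_submod_closed : submod_closed dual_pred.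
Proof.
split.
  apply/asboolP; split; last exact: cst_continuous.
  by move=> a u v; rewrite /= scaler0 addr0.
move=> a f g /asboolP[lf cf] /asboolP[lg cg]; apply/asboolP; split.
  move=> b u v; rewrite !fctE lf lg !scalerDr !scalerA (mulrC a b).
  by rewrite addrACA.
move=> x; apply: cvgD; last exact: cg.
by apply: cvgZl_tmp; exact: cf.
Qed.

HB.instance Definition _ :=
  GRing.isSubmodClosed.Build R (X -> R^o) dual_pred dual_submod_closed.

Record dual := Dual { dual_fun :> X -> R^o ; _ : dual_fun \in dual_pred }.

HB.instance Definition _ := [isSub for dual_fun].
HB.instance Definition _ := [Choice of dual by <:].
HB.instance Definition _ := [SubChoice_isSubLmodule of dual by <:].

Lemma dual_linear (f : dual) : linear f.
Proof. by have /asboolP[] := valP f. Qed.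

Lemma dual_continuous (f : dual) : continuous f.
Proof. by have /asboolP[] := valP f. Qed.

HB.instance Definition _ (f : dual) :=
  GRing.isLinear.Build R X R^o _ (dual_fun f) (dual_linear f).

Definition dual_norm (f : dual) : R :=
  sup [set `|f x| | x in [set x | `|x| <= 1]].

Lemma dual_norm_has_sup (f : dual) :
  has_sup [set `|f x| | x in [set x | `|x| <= 1]].
Proof.
split; first by exists `|f 0|, 0 => //=; rewrite normr0 ler01.
have /bounded_funP/(_ 1)[M fM] : bounded_near (f : {linear X -> R^o}) (nbhs 0).
  exact/linear_bounded_continuous/dual_continuous.
by exists M => _ [x /= x1 <-]; exact: fM.
Qed.

Lemma le_dual_norm (f : dual) (x : X) : `|f x| <= dual_norm f * `|x|.
Proof.
have [->|x0] := eqVneq x 0; first by rewrite linear0 !normr0 mulr0.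
have nx0 : 0 < `|x| by rewrite normr_gt0.
rewrite -ler_pdivrMr// mulrC.
have -> : `|x|^-1 * `|f x| = `|f (`|x|^-1 *: x)|.
  by rewrite linearZ normrZ ger0_norm// invr_ge0.
apply: ub_le_sup; first exact: (dual_norm_has_sup f).2.
by exists (`|x|^-1 *: x) => //=; rewrite normrZ normfV normr_id mulVf ?gt_eqF.
Qed.

Lemma dual_norm_le (f : dual) (M : R) :
  (forall x, `|x| <= 1 -> `|f x| <= M) -> dual_norm f <= M.
Proof.
move=> fM; apply: ge_sup; first exact: (dual_norm_has_sup f).1.
by move=> _ [x /= x1 <-]; exact: fM.
Qed.

Lemma dual_norm_ge0 (f : dual) : 0 <= dual_norm f.
Proof.
apply: (@le_trans _ _ `|f 0|) => //.
apply: ub_le_sup; first exact: (dual_norm_has_sup f).2.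
by exists 0 => //=; rewrite normr0 ler01.
Qed.

Lemma dual_normD (f g : dual) : dual_norm (f + g) <= dual_norm f + dual_norm g.
Proof.
apply: dual_norm_le => x x1; rewrite (le_trans (ler_normD _ _))// lerD//.
- by rewrite (le_trans (le_dual_norm _ _))// ler_piMr// dual_norm_ge0.
- by rewrite (le_trans (le_dual_norm _ _))// ler_piMr// dual_norm_ge0.
Qed.

Lemma dual_normZ (a : R) (f : dual) : dual_norm (a *: f) = `|a| * dual_norm f.
Proof.
have le b g : dual_norm (b *: g) <= `|b| * dual_norm g.
  apply: dual_norm_le => x x1; rewrite [leLHS](normrM b (g x)) ler_wpM2l//.
  by rewrite (le_trans (le_dual_norm _ _))// ler_piMr// dual_norm_ge0.
apply/eqP; rewrite eq_le le/=.
have [->|a0] := eqVneq a 0; first by rewrite normr0 mul0r dual_norm_ge0.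
rewrite -ler_pdivlMl ?normr_gt0// -normfV.
by rewrite -[f in leLHS](scalerK a0) le.
Qed.

Lemma dual_norm0_eq0 (f : dual) : dual_norm f = 0 -> f = 0.
Proof.
move=> f0; apply/val_inj/funext => x; apply/normr0_eq0/le_anti.
by rewrite normr_ge0 andbT (le_trans (le_dual_norm f x))// f0 mul0r.
Qed.

HB.instance Definition _ :=
  Lmodule_isNormed.Build R dual dual_normD dual_normZ dual_norm0_eq0.

Lemma dual_normE (f : dual) :
  `|f| = sup [set `|f x| | x in [set x | `|x| <= 1]].
Proof. by []. Qed.

End Dual.

Definition is_closed_subspace {R : realType} {X : normedModType R}
    (A : set X) : Prop :=
  [/\ A 0, forall (a : R) u v, A u -> A v -> A (a *: u + v) & closed A].

Record closedSubspace {R : realType} (X : normedModType R) := ClosedSubspace {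
  cs_set :> set X ;
  cs_setP : is_closed_subspace cs_set }.

Section ClosedSubspaceType.
Context {R : realType} (X : completeNormedModType R) (Y : closedSubspace X).

Definition cs_pred : {pred X} := fun x => `[< cs_set Y x >].

Lemma cs_submod_closed : submod_closed cs_pred.
Proof.
have [Y0 YD _] := cs_setP Y; split; first exact/asboolP.
by move=> a u v /asboolP Yu /asboolP Yv; apply/asboolP; exact: YD.
Qed.

HB.instance Definition _ :=
  GRing.isSubmodClosed.Build R X cs_pred cs_submod_closed.

Record cs_type := CsType { cs_val : X ; _ : cs_val \in cs_pred }.

HB.instance Definition _ := [isSub for cs_val].
HB.instance Definition _ := [Choice of cs_type by <:].
HB.instance Definition _ := [SubChoice_isSubLmodule of cs_type by <:].

Lemma cs_valP (y : cs_type) : cs_set Y (cs_val y).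
Proof. by have /asboolP := valP y. Qed.

Let cs_normD (x y : cs_type) :
  `|cs_val (x + y)| <= `|cs_val x| + `|cs_val y|.
Proof. exact: ler_normD. Qed.

Let cs_normZ (a : R) (x : cs_type) : `|cs_val (a *: x)| = `|a| * `|cs_val x|.
Proof. exact: normrZ. Qed.

Let cs_norm0_eq0 (x : cs_type) : `|cs_val x| = 0 -> x = 0.
Proof. by move=> /normr0_eq0 x0; exact: val_inj. Qed.

HB.instance Definition _ :=
  Lmodule_isNormed.Build R cs_type cs_normD cs_normZ cs_norm0_eq0.

Lemma cs_normE (y : cs_type) : `|y| = `|cs_val y|.
Proof. by []. Qed.

Lemma cs_complete (F : set_system cs_type) :
  ProperFilter F -> cauchy F -> cvg F.
Proof.
move=> FF /cauchy_ballP Fc.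
have : cauchy (cs_val @ F).
  apply/cauchy_ballP => e e0; have := Fc e e0.
  rewrite !near_simpl => -[[A B]/= [FA FB] AB].
  exists (cs_val @` A, cs_val @` B) => /=.
    by split; [apply: filterS FA|apply: filterS FB] => x; exists x.
  move=> [_ _] /= [[x Ax <-] [y By <-]].
  have := AB (x, y) (conj Ax By).
  by rewrite -!ball_normE /ball_ /=.
move=> /cauchy_cvg/cvg_ex[/= l Fl].
have Yl : cs_set Y l.
  have [_ _ cY] := cs_setP Y.
  apply: (closed_cvg _ cY _ _ Fl).
  by apply: nearW => y; exact: cs_valP.
apply/cvg_ex; exists (CsType (asboolT Yl : l \in cs_pred)).
apply/cvgrPdist_lt => e e0.
by move/cvgrPdist_lt : Fl => /(_ e e0).
Qed.

HB.instance Definition _ := Uniform_isComplete.Build cs_type cs_complete.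

End ClosedSubspaceType.

Definition slice {R : realType} {X : normedModType R} (f : dual X) (e : R) :
  set X := [set x | `|x| <= 1 /\ 1 - e < f x].

Definition opp_slice {R : realType} {X : normedModType R} (f : dual X)
  (e : R) : set X := [set - x | x in slice f e].

Definition dist_set {R : realType} {X : normedModType R} (x : X) (A : set X) :
  R := inf [set `|x - a| | a in A].

(* Every slice below contains [x], hence is nonempty, so [dist_set] is never
   applied to the empty set. *)
Definition GL_space {R : realType} (X : completeNormedModType R) : Prop :=
  forall x : X, `|x| = 1 -> forall e : R, 0 < e ->
  exists f : dual X, [/\ `|f| = 1, slice f e x &
    forall y : X, `|y| = 1 ->
      dist_set y (slice f e) + dist_set y (opp_slice f e) < 2 + e].

Definition is_norm {R : realType} {V : lmodType R} (N : V -> R) : Prop :=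
  [/\ forall u v, N (u + v) <= N u + N v,
      forall a u, N (a *: u) = `|a| * N u &
      forall u, N u = 0 -> u = 0].

Definition absolute_norm {R : realType} (F : R^o * R^o -> R) : Prop :=
  forall a b : R, F (a, b) = F (`|a|, `|b|).

Definition normalised_norm {R : realType} (F : R^o * R^o -> R) : Prop :=
  F (1, 0) = 1 /\ F (0, 1) = 1.

Definition abs_normalised_norm {R : realType} (F : R^o * R^o -> R) : Prop :=
  [/\ is_norm F, absolute_norm F & normalised_norm F].

(* For a norm [F] the supremum is over a nonempty set, bounded because all norms
   on the plane are equivalent, so [sup] never takes its default value. *)
Definition reversed_dual {R : realType} (F : R^o * R^o -> R) :
    R^o * R^o -> R :=
  fun p => sup [set `|p.1 * w.2 + p.2 * w.1| | w in [set w | F w <= 1]].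

Definition extreme_point {R : realType} {V : lmodType R} (A : set V) (x : V) :
    Prop :=
  A x /\ forall (y z : V) (t : R), A y -> A z -> 0 < t -> t < 1 ->
    x = t *: y + (1 - t) *: z -> y = x /\ z = x.

Definition G_projection {R : realType} (G : R^o * R^o -> R)
    {X : normedModType R} (P : {linear X -> X}) : Prop :=
  (forall x, P (P x) = P x) /\ (forall x, `|x| = G (`|P x|, `|x - P x|)).

Definition G_summand {R : realType} (G : R^o * R^o -> R)
    {X : normedModType R} (A : set X) : Prop :=
  is_closed_subspace A /\
  exists P : {linear X -> X}, G_projection G P /\ range P = A.

Definition annihilator {R : realType} {X : normedModType R} (A : set X) :
  set (dual X) := [set f | forall y, A y -> f y = 0].

Definition F_ideal {R : realType} (F : R^o * R^o -> R)
    {X : normedModType R} (A : set X) : Prop :=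
  is_closed_subspace A /\ G_summand (reversed_dual F) (annihilator A).

(* Main.v *)
Require Import Defs.
From HB Require Import structures.
From mathcomp Require Import all_boot all_order all_algebra.
From mathcomp Require Import all_classical all_reals all_analysis.
From mathcomp Require Import ring lra.

Set Implicit Arguments.
Unset Strict Implicit.
Unset Printing Implicit Defensive.

Import Order.TTheory GRing.Theory Num.Theory.
Import numFieldNormedType.Exports.

Local Open Scope classical_set_scope.
Local Open Scope ring_scope.

(** The dual of [Y] sits inside the dual of [X]: if [P] is the projection onto
    the annihilator of [Y] and [f] is a functional on [X], then [f - P f] agrees
    with [f] on [Y] and has norm at most [`|f|].

    Take a unit vector [y0] of [Y] and a functional [f] of norm 1 whose slice
    witnesses the GL property of [X] at [y0], for a tolerance [delta].  Put
    [h = f - P f].  As [h] and [f] agree at [y0], [`|h| > 1 - delta], whereas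
    [(`|P f|, `|h|)] lies in the unit ball of the reversed dual norm.  Since
    [(0, 1)] is an extreme point of that ball, a point of the ball whose second
    coordinate is close to 1 has a small first coordinate
    ([extreme_small_fst]).  So [P f] is small, and [h] is almost maximal on the
    whole slice of [f].  The functional wanted on [Y] is the restriction of [h]
    divided by its own norm.

    The distances from a unit vector [y] of [Y] to the slice and to the opposite
    slice must now be reached inside [Y].  Given [x] in the slice of [f],
    [subspace_approximation] supplies [u] in [Y] whose norm, distance to [y] and
    value under [h] are as good as those of [x] up to an arbitrarily small
    error.  It stands in for the weak-star density of the balls of [Y] in those
    of its bidual: if no such [u] existed, with [a], [b] and [kappa] the bounds
    asked for, a Hahn-Banach argument would give functionals [f1] and [g1] on
    [X] with [f1 + g1 = h] on [Y] and
    [a * `|f1| + b * `|g1| + g1 y <= kappa < h x].  Subtracting from each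
    functional its image under [P] makes the identity hold on all of [X] without
    increasing norms, and evaluating it at [x] is then a contradiction.

    The Hahn-Banach theorem is used in the form [cone_minorant]: a convex cone
    in [V * R] that projects onto [V] and contains no [(0, s)] with [s < 0] lies
    above the graph of a linear functional. *)

(** * The Hahn-Banach theorem for convex cones *)

Section ConeMinorant.
Context {R : realType} (V : lmodType R).
Implicit Types (K : set (V * R)) (v : V) (s : R).

(** The cones that can lie above the graph of a linear functional: the last
    clause keeps them off the downward vertical axis.  Epigraphs of sublinear
    functionals are the usual examples. *)
Definition pointed_cone K : Prop :=
  [/\ K (0, 0),
      forall v w s t, K (v, s) -> K (w, t) -> K (v + w, s + t),
      forall c v s, 0 < c -> K (v, s) -> K (c *: v, c * s) &
      forall s, K (0, s) -> 0 <= s].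

Lemma maximal_pointed_cone K : pointed_cone K ->
  exists M, [/\ pointed_cone M, K `<=` M &
    forall N, pointed_cone N -> M `<=` N -> N `<=` M].
Proof.
(* Zorn is applied to the sets that yield a pointed cone once [K] is added, so
   that the union of the empty chain also qualifies. *)
move=> Kc; pose P (A : set (V * R)) := pointed_cone (K `|` A).
have [|A [PA Amax]] := @Zorn_bigcup _ P.
  move=> C CP Ctot.
  have sub A : C A -> K `|` A `<=` K `|` \bigcup_(X in C) X.
    by move=> CA x [|Ax]; [left|right; exists A].
  have one x : (K `|` \bigcup_(X in C) X) x ->
      K x \/ exists2 A, C A & (K `|` A) x.
    by case=> [|[A CA Ax]]; [left|right; exists A => //; right].
  have K1 A : K `<=` K `|` A by move=> x; left.
  have [K00 KD KZ K0] := Kc.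
  split=> [|v w s t /one[Kv|[A CA Av]] /one[Kw|[B CB Bw]]
          |c v s c0 /one[Kv|[A CA Av]]|s /one[|[A CA]]].
  - exact: K1.
  - by apply: K1; exact: KD.
  - by apply: (sub B) => //; have [_ D _ _] := CP _ CB;
    apply: D => //; exact: K1.
  - by apply: (sub A) => //; have [_ D _ _] := CP _ CA;
    apply: D => //; exact: K1.
  - have [AB|BA] := Ctot _ _ CA CB.
      apply: (sub B) => //; have [_ D _ _] := CP _ CB; apply: D => //.
      by case: Av; [left|move/AB; right].
    apply: (sub A) => //; have [_ D _ _] := CP _ CA; apply: D => //.
    by case: Bw; [left|move/BA; right].
  - by apply: K1; exact: KZ.
  - by apply: (sub A) => //; have [_ _ Z _] := CP _ CA; exact: Z.
  - exact: K0.
  - by have [_ _ _] := CP _ CA; exact.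
exists (K `|` A); split=> [//|x Kx|N Nc AN x Nx]; first by left.
apply: contrapT => nx; apply: (Amax N); last first.
  by rewrite /P setUidr// => z Kz; apply: AN; left.
split=> [z Az|/(_ _ Nx) Ax]; first by apply: AN; right.
by apply: nx; right.
Qed.

(** Adjoining the ray through [(v, s)] to a maximal cone either changes nothing
    or destroys pointedness, and the latter puts a point strictly below
    [- (v, s)] in the cone.  This is what makes the lower boundary of a maximal
    cone odd, hence linear. *)
Lemma maximal_pointed_cone_total M v s : pointed_cone M ->
  (forall N, pointed_cone N -> M `<=` N -> N `<=` M) ->
  M (v, s) \/ exists2 r, 0 < r & M (- v, - s - r).
Proof.
move=> [M00 MD MZ M0] Mmax.
have [//|nM] := pselect (exists2 r, 0 < r & M (- v, - s - r)); first by right.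
left.
pose N : set (V * R) :=
  [set p | exists2 c, 0 <= c & M (p.1 - c *: v, p.2 - c * s)].
apply: (Mmax N) => [|[w t] Mw|]; last 2 first.
- by exists 0; rewrite //= scale0r mul0r !subr0.
- by exists 1; rewrite //= scale1r mul1r !subrr.
split.
- by exists 0; rewrite //= scale0r mul0r !subr0.
- move=> w w' t t' [c c0 Mw] [c' c'0 Mw'] /=.
  exists (c + c'); first exact: addr_ge0.
  by rewrite /= scalerDl mulrDl !opprD addrACA [X in (_, X)]addrACA; exact: MD.
- move=> d w t d0 [c c0 Mw]; exists (d * c); first by rewrite mulr_ge0// ltW.
  by rewrite /= -scalerA -scalerBr -mulrA -mulrBr; exact: MZ.
- move=> t [c c0 /=]; rewrite !sub0r => Mt.
  move: c0; rewrite le_eqVlt => /predU1P[c0|c0].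
    by move: Mt; rewrite -c0 scale0r oppr0 mul0r subr0; exact: M0.
  rewrite leNgt; apply/negP => t0; apply: nM.
  exists (c^-1 * - t); first by rewrite mulr_gt0 ?invr_gt0 ?oppr_gt0.
  have := MZ c^-1 _ _ _ Mt; rewrite invr_gt0 => /(_ c0).
  rewrite scalerN scalerA mulVf ?gt_eqF// scale1r mulrBr mulrA mulVf ?gt_eqF//.
  by rewrite mul1r mulrN opprK addrC.
Qed.

(** The Hahn-Banach theorem for cones: the functional is the lower boundary
    [phi] of a maximal cone containing [K].  It is sublinear because the cone is
    convex, and [maximal_pointed_cone_total] makes it odd. *)
Lemma cone_minorant K : pointed_cone K -> (forall v, exists s, K (v, s)) ->
  exists phi : {linear V -> R^o}, forall v s, K (v, s) -> phi v <= s.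
Proof.
move=> /maximal_pointed_cone[M [Mc KM Mmax]] Kproj.
have tot v s := maximal_pointed_cone_total v s Mc Mmax.
have [M00 MD MZ M0] := Mc.
pose S v : set R := [set s | M (v, s)]; pose phi v : R := inf (S v).
have S0 v : S v !=set0 by have [s /KM] := Kproj v; exists s.
have Slb v : has_lbound (S v).
  have [t Mt] := S0 (- v); exists (- t) => s Ms; rewrite -subr_ge0 opprK.
  by apply: M0; rewrite -(subrr v); exact: MD.
have phi_le v s : M (v, s) -> phi v <= s by move=> Ms; exact: ge_inf.
have le_phi v t : (forall s, M (v, s) -> t <= s) -> t <= phi v.
  by move=> h; apply: lb_le_inf.
have phiD v w : phi (v + w) <= phi v + phi w.
  rewrite -lerBlDr; apply: (le_phi _ _) => s Ms.
  rewrite lerBlDr -lerBlDl; apply: (le_phi _ _) => t Mt.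
  by rewrite lerBlDl; apply: phi_le; exact: MD.
have phi0 : 0 <= phi 0 by apply: (le_phi _ _) => s; exact: M0.
have phiN v : phi (- v) = - phi v.
  apply/eqP; rewrite eq_le; apply/andP; split.
    rewrite lerNr leNgt; apply/negP => lt.
    have [/phi_le|[r r0 /phi_le]] := tot v (- phi (- v)).
      by rewrite leNgt lt.
    by rewrite opprK lerBrDr gerDl leNgt r0.
  by rewrite -subr_ge0 opprK (le_trans phi0)// -(addNr v) phiD.
have {}phiD v w : phi (v + w) = phi v + phi w.
  apply/eqP; rewrite eq_le phiD/= -lerN2 -phiN !opprD -!phiN.
  exact: phiD.
have phiZ_le c v : 0 < c -> phi (c *: v) <= c * phi v.
  move=> c0; rewrite -ler_pdivrMl//; apply: (le_phi _ _) => s Ms.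
  by rewrite ler_pdivrMl//; apply: phi_le; exact: MZ.
have phiZp c v : 0 < c -> phi (c *: v) = c * phi v.
  move=> c0; apply/eqP; rewrite eq_le phiZ_le//= -ler_pdivlMl//.
  rewrite -{1}[v](scalerK (lt0r_neq0 c0)).
  by apply: phiZ_le; rewrite invr_gt0.
have phiZ c v : phi (c *: v) = c * phi v.
  have [c0|c0|->] := ltgtP c 0; last 2 first.
  - exact: phiZp.
  - rewrite scale0r mul0r; apply/eqP; rewrite eq_le phi0 andbT.
    exact: phi_le.
  rewrite -[c]opprK scaleNr phiN phiZp ?oppr_gt0//.
  by rewrite !mulNr.
have lphi : linear (phi : V -> R^o) by move=> c v w; rewrite phiD phiZ.
pose L := GRing.isLinear.Build R V R^o *:%R phi lphi.
pose Phi : {linear V -> R^o} := HB.pack phi L.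
by exists Phi => v s /KM; exact: phi_le.
Qed.

End ConeMinorant.

(** * The reversed dual norm near an extreme point *)

Section ReversedDual.
Context {R : realType} (F : R^o * R^o -> R).
Hypothesis F_norm : abs_normalised_norm F.

Let F_abs (a b : R) : F (a, b) = F (`|a|, `|b|).
Proof. by case: F_norm. Qed.

(** Averaging [(u, v)] with its reflection [(u, - v)], which has the same norm,
    yields [(u, 0)]. *)
Lemma abs_norm_ge_fst (u v : R) : `|u| <= F (u, v).
Proof.
have [[FD FZ _] _ [F10 _]] := F_norm.
have := FD (u, v) (u, - v).
rewrite (F_abs u (- v)) normrN -F_abs.
have -> : ((u, v) + (u, - v) : R^o * R^o) = (2 * u) *: (1, 0).
  by congr (_, _); rewrite /= ?scaler0 ?subrr//;
    rewrite /GRing.scale/= mulr1; ring.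
by rewrite FZ F10 normrM (@ger0_norm _ 2)//; lra.
Qed.

Lemma abs_norm_ge_snd (u v : R) : `|v| <= F (u, v).
Proof.
have [[FD FZ _] _ [_ F01]] := F_norm.
have := FD (u, v) (- u, v).
rewrite (F_abs (- u) v) normrN -F_abs.
have -> : ((u, v) + (- u, v) : R^o * R^o) = (2 * v) *: (0, 1).
  by congr (_, _); rewrite /= ?scaler0 ?subrr//;
    rewrite /GRing.scale/= mulr1; ring.
by rewrite FZ F01 normrM (@ger0_norm _ 2)//; lra.
Qed.

Lemma reversed_dual_ge (a b u v : R) : F (u, v) <= 1 ->
  `|a * v + b * u| <= reversed_dual F (a, b).
Proof.
move=> Fuv; apply: ub_le_sup; last by exists (u, v).
exists (`|a| + `|b|) => _ [[u' v'] /= F1 <-].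
rewrite (le_trans (ler_normD _ _))// lerD// normrM ler_piMr//.
  exact: le_trans (abs_norm_ge_snd _ _) F1.
exact: le_trans (abs_norm_ge_fst _ _) F1.
Qed.

Lemma reversed_dual_le (a b c : R) :
  (forall u v, F (u, v) <= 1 -> `|a * v + b * u| <= c) ->
  reversed_dual F (a, b) <= c.
Proof.
move=> h; apply: ge_sup => [|_ [[u v] /= /h + <-]//].
exists 0, (0, 0) => /=; last by rewrite !mulr0 addr0 normr0.
have [[_ FZ _] _ _] := F_norm.
by rewrite -[(0, 0)](scale0r (0 : R^o * R^o)) FZ normr0 mul0r.
Qed.

Lemma reversed_dual_oppl (a b : R) :
  reversed_dual F (- a, b) <= reversed_dual F (a, b).
Proof.
apply: reversed_dual_le => u v F1; rewrite mulNr -mulrN.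
by apply: reversed_dual_ge; rewrite F_abs normrN -F_abs.
Qed.

Lemma reversed_dual_mono (a a' b b' : R) : 0 <= a <= a' -> 0 <= b <= b' ->
  reversed_dual F (a, b) <= reversed_dual F (a', b').
Proof.
move=> /andP[a0 aa'] /andP[b0 bb']; apply: reversed_dual_le => u v F1.
apply: (@le_trans _ _ `|a' * `|v| + b' * `|u| |).
  rewrite [leRHS]ger0_norm; last first.
    by rewrite addr_ge0// mulr_ge0 ?(le_trans a0 aa') ?(le_trans b0 bb').
  rewrite (le_trans (ler_normD _ _))// !normrM (ger0_norm a0) (ger0_norm b0).
  by rewrite lerD// ler_wpM2r.
by apply: reversed_dual_ge; rewrite -F_abs.
Qed.

Lemma ge_reversed_dual_snd (a b : R) : b <= reversed_dual F (a, b).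
Proof.
have [_ _ [F10 _]] := F_norm.
have := @reversed_dual_ge a b 1 0; rewrite F10 mulr0 add0r mulr1.
by move=> /(_ (lexx _)); apply: le_trans; exact: ler_norm.
Qed.

Lemma reversed_dual_lip_snd (a b c : R) : b <= c ->
  reversed_dual F (a, c) <= reversed_dual F (a, b) + (c - b).
Proof.
move=> bc; apply: reversed_dual_le => u v F1.
have -> : a * v + c * u = a * v + b * u + (c - b) * u by ring.
rewrite (le_trans (ler_normD _ _))// lerD ?reversed_dual_ge//.
rewrite normrM ger0_norm ?subr_ge0// ler_piMr ?subr_ge0//.
exact: le_trans (abs_norm_ge_fst _ _) F1.
Qed.

(** A point [(eta, 1)] of the ball would make [(0, 1)] the midpoint of
    [(eta, 1)] and [(- eta, 1)]; so its norm exceeds 1, and [delta] is the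
    excess.  A point [(a, b)] of the ball with [eta <= a] would give, by
    monotonicity, the point [(eta, b)] of the ball, whose distance to [(eta, 1)]
    is [1 - b] and hence must be at least [delta]. *)
Lemma extreme_small_fst (eta : R) :
  extreme_point [set p | reversed_dual F p <= 1] (0, 1) -> 0 < eta ->
  exists2 delta, 0 < delta & forall a b, 0 <= a -> 0 <= b ->
    reversed_dual F (a, b) <= 1 -> 1 - delta < b -> a < eta.
Proof.
move=> [_ ext] eta0.
have eta1 : 1 < reversed_dual F (eta, 1).
  rewrite ltNge; apply/negP => le1.
  have le1' := le_trans (reversed_dual_oppl _ _) le1.
  have [] := ext (eta, 1) (- eta, 1) 2^-1 le1 le1'.
  - by rewrite invr_gt0.
  - by rewrite invf_lt1 ?ltr1n.
  - congr (_, _).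
      by change (0 = 2^-1 * eta + (1 - 2^-1) * - eta :> R); field.
    by change (1 = 2^-1 * 1 + (1 - 2^-1) * 1 :> R); field.
  - by case=> eta0'; move: eta0; rewrite eta0' ltxx.
exists (reversed_dual F (eta, 1) - 1); first by rewrite subr_gt0.
move=> a b a0 b0 ab1 db; rewrite ltNge; apply/negP => etaa.
have b1 : b <= 1 := le_trans (ge_reversed_dual_snd a b) ab1.
have := reversed_dual_lip_snd eta b1.
have : reversed_dual F (eta, b) <= reversed_dual F (a, b).
  by apply: reversed_dual_mono; rewrite ?lexx ?(ltW eta0) ?b0.
lra.
Qed.

End ReversedDual.

(** * Approximating points of the space inside the ideal *)

Section Approximation.
Context {R : realType} (X : normedModType R).

Lemma dual_of_bounded (f : {linear X -> R^o}) (M : R) :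
  (forall x, `|x| <= 1 -> `|f x| <= M) -> exists g : dual X, g =1 f.
Proof.
move=> fM; have cf : continuous f.
  apply/linear_bounded_continuous/bounded_funP => r.
  exists (M * `|r|) => x xr; have [x0|x0] := eqVneq x 0.
    have M0 : 0 <= M by rewrite (le_trans _ (fM 0 _)) ?normr0.
    by rewrite x0 linear0 normr0 mulr_ge0.
  have nx0 : 0 < `|x| by rewrite normr_gt0.
  have := fM (`|x|^-1 *: x).
  rewrite normrZ normfV normr_id mulVf ?gt_eqF// => /(_ (lexx _)).
  rewrite linearZ normrZ normfV normr_id ler_pdivrMl// => /le_trans; apply.
  have M0 : 0 <= M by rewrite (le_trans _ (fM 0 _)) ?normr0.
  by rewrite mulrC ler_wpM2l// (le_trans xr)// ler_norm.
have df : (f : X -> R^o) \in @dual_pred R X.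
  by apply/asboolP; split=> //; exact: linearP.
by exists (Dual df).
Qed.

Lemma dual_norm_le_linear (f : dual X) (a c : R) : 0 < a ->
  (forall x, `|x| <= 1 -> a * f x <= c) -> a * `|f| <= c.
Proof.
move=> a0 fc; rewrite -ler_pdivlMl//; apply: dual_norm_le => x x1.
rewrite ler_pdivlMl//; case: ger0P => _; first exact: fc.
by have := fc (- x); rewrite normrN linearN; exact.
Qed.

Lemma dual_bound (f : dual X) (x : X) (r : R) : `|x| <= r -> f x <= `|f| * r.
Proof.
move=> xr; apply: le_trans (ler_norm _) (le_trans (le_dual_norm _ _) _).
by rewrite ler_wpM2l// dual_norm_ge0.
Qed.

(** A substitute for the weak-star density of the balls of [Y] in those of its
    bidual, applied to the image of [x] there.  If no [u] exists, the linear
    form [phi] on [X * X] obtained from [cone_minorant] splits as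
    [phi (v, w) = f v + g w]; it is at most [kappa] on the product of the ball
    of radius [a] around 0 and the ball of radius [b] around [y], and at most
    [h u] at the diagonal points [(u, u)] with [u] in [Y].  The projection [P]
    then turns [f + g = h] on [Y] into an identity on [X], which fails at
    [x]. *)
Lemma subspace_approximation (Y : set X) (P : {linear dual X -> dual X})
    (h : dual X) (x y : X) (a b kappa : R) :
  is_closed_subspace Y -> range P = annihilator Y ->
  (forall f, P (P f) = P f) -> (forall f, `|f - P f| <= `|f|) ->
  P h = 0 -> Y y -> `|y| < a -> 0 < b ->
  `|x| <= a -> `|x - y| <= b -> kappa < h x ->
  exists u, [/\ Y u, `|u| <= a, `|u - y| <= b & kappa < h u].
Proof.
move=> [Y0 Ylin _] rP PP Pn Ph Yy ya b0 xa xyb kx; apply: contrapT => nex.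
have hle u : Y u -> `|u| <= a -> `|u - y| <= b -> h u <= kappa.
  by move=> Yu ua ub; rewrite leNgt; apply/negP => hu; apply: nex; exists u.
have YZ c u : Y u -> Y (c *: u).
  by move=> Yu; rewrite -[_ *: _]addr0; exact: Ylin.
have YD u v : Y u -> Y v -> Y (u + v).
  by move=> Yu; rewrite -[u]scale1r; exact: Ylin.
(* The cone generated by the points [((u, u), h u)], [u] in [Y], and the points
   [((v, w), kappa)] with [v] and [w] in the two balls; [t] is the total weight
   of the latter. *)
pose K : set ((X * X) * R) := [set p | exists u t, [/\ Y u, 0 <= t,
  `|p.1.1 - u| <= t * a, `|p.1.2 - u - t *: y| <= t * b &
  p.2 = h u + t * kappa]].
have Kc : pointed_cone K.
  split.
  - exists 0, 0; split=> //=; last by rewrite linear0 mul0r addr0.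
      by rewrite subr0 normr0 mul0r.
    by rewrite scale0r !subr0 normr0 mul0r.
  - move=> [v w] [v' w'] s s' [u [t [Yu t0 /= vu wu ->]]].
    move=> [u' [t' [Yu' t'0 /= vu' wu' ->]]].
    exists (u + u'), (t + t'); split=> /=.
    + exact: YD.
    + exact: addr_ge0.
    + rewrite opprD addrACA mulrDl.
      by rewrite (le_trans (ler_normD _ _))// lerD.
    + have -> : w + w' - (u + u') - (t + t') *: y =
          (w - u - t *: y) + (w' - u' - t' *: y).
        by rewrite [RHS]addrACA (addrACA w (- u)) scalerDl !opprD.
      rewrite mulrDl.
      by rewrite (le_trans (ler_normD _ _))// lerD.
    + by rewrite linearD mulrDl addrACA.
  - move=> c [v w] s c0 [u [t [Yu t0 /= vu wu ->]]].
    exists (c *: u), (c * t); split=> /=.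
    + exact: YZ.
    + by rewrite mulr_ge0// ltW.
    + by rewrite -scalerBr normrZ gtr0_norm// -mulrA ler_pM2l.
    + by rewrite -scalerA -!scalerBr normrZ gtr0_norm// -mulrA ler_pM2l.
    + by rewrite linearZ mulrDr mulrA.
  - move=> s [u [t [Yu t0 /=]]]; rewrite !sub0r normrN => ut uyt ->.
    move: t0; rewrite le_eqVlt => /predU1P[t0|t0].
      move: ut; rewrite -t0 mul0r normr_le0 => /eqP ->.
      by rewrite linear0 mul0r addr0.
    have : h (- t^-1 *: u) <= kappa.
      apply: hle; first exact: YZ.
        by rewrite normrZ normrN normfV gtr0_norm// ler_pdivrMl.
      rewrite -(@ler_pM2l _ t)// -[X in X * _ <= _](gtr0_norm t0) -normrZ.
      by rewrite scalerBr scalerA mulrN mulfV ?gt_eqF// scaleN1r.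
    rewrite linearZ /= -(@ler_pM2l _ t)//.
    by rewrite [_ *: _]mulNr mulrN mulVKf ?gt_eqF//; lra.
have Kproj p : exists s, K (p, s).
  case: p => v w.
  pose t := `|v| / (a - `|y|) + `|w| / b.
  have ay : 0 < a - `|y| by rewrite subr_gt0.
  have t0 : 0 <= t by rewrite addr_ge0// divr_ge0// ltW.
  exists (h (- t *: y) + t * kappa), (- t *: y), t; split=> //=.
  - exact: YZ.
  - rewrite scaleNr opprK (le_trans (ler_normD _ _))// normrZ ger0_norm//.
    rewrite -lerBrDr -mulrBr mulrDl divfK ?gt_eqF// lerDl mulr_ge0 ?(ltW ay)//.
    by rewrite divr_ge0// ltW.
  - rewrite scaleNr opprK addrK mulrDl divfK ?gt_eqF// lerDr.
    rewrite mulr_ge0 ?(ltW b0)//.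
    by rewrite divr_ge0// ltW.
(* Pointedness of [K] was the assumption that [h <= kappa] on [Y] within the two
   balls; [y], a point of [Y] and the centre of one ball, is interior to the
   other ball, so [K] projects onto [X * X]. *)
have [phi phiK] := cone_minorant Kc Kproj.
pose f0 v : R^o := phi (v, 0); pose g0 w : R^o := phi (0, w).
have phiE v w : phi (v, w) = f0 v + g0 w.
  by rewrite /f0 /g0 -linearD; congr (phi (_, _)); rewrite /= ?addr0 ?add0r.
have f0lin : linear f0.
  by move=> c v w; rewrite /f0 -linearP; congr (phi (_, _));
    rewrite /= scaler0 addr0.
have g0lin : linear g0.
  by move=> c v w; rewrite /g0 -linearP; congr (phi (_, _));
    rewrite /= scaler0 addr0.
pose f1 : {linear X -> R^o} :=
  HB.pack f0 (GRing.isLinear.Build R X R^o *:%R f0 f0lin).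
pose g1 : {linear X -> R^o} :=
  HB.pack g0 (GRing.isLinear.Build R X R^o *:%R g0 g0lin).
have a0 : 0 < a by exact: le_lt_trans ya.
have fgball v w : `|v| <= 1 -> `|w| <= 1 ->
    a * f1 v + b * g1 w + g1 y <= kappa.
  move=> v1 w1.
  have : phi (a *: v, b *: w + y) <= h 0 + 1 * kappa.
    apply: phiK; exists 0, 1; split=> //=.
      by rewrite subr0 mul1r normrZ gtr0_norm// ler_piMr// ltW.
    by rewrite subr0 scale1r addrK mul1r normrZ gtr0_norm// ler_piMr// ltW.
  rewrite phiE linear0 add0r mul1r; apply: le_trans.
  by rewrite -[f0]/(f1 : X -> R^o) -[g0]/(g1 : X -> R^o) linearD !linearZ addrA.
have fsym c (k : {linear X -> R^o}) (d : R) : 0 < c ->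
    (forall v, `|v| <= 1 -> c * k v <= d) ->
    forall v, `|v| <= 1 -> `|k v| <= c^-1 * d.
  move=> c0 kd v v1; rewrite ler_pdivlMl//.
  have := kd v v1; have := kd (- v); rewrite normrN linearN mulrN => /(_ v1).
  by case: ger0P => _; rewrite ?mulrN; lra.
have [|f fE] := @dual_of_bounded f1 (a^-1 * (kappa - g1 y)).
  apply: fsym => // v v1; have := fgball v 0 v1.
  by rewrite normr0 linear0 => /(_ ler01); lra.
have [|g gE] := @dual_of_bounded g1 (b^-1 * (kappa - g1 y)).
  apply: fsym => // w w1; have := fgball 0 w _ w1.
  by rewrite normr0 linear0 => /(_ ler01); lra.
have fg_norm : a * `|f| + b * `|g| + g y <= kappa.
  rewrite -lerBrDr -lerBrDl; apply: dual_norm_le_linear => // w w1.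
  rewrite lerBrDl -lerBrDr; apply: dual_norm_le_linear => // v v1.
  by have := fgball v w v1 w1; rewrite -fE -!gE; lra.
have fg_le u : Y u -> f u + g u <= h u.
  move=> Yu; rewrite fE gE -[leLHS]phiE.
  apply: phiK; exists u, 0; split=> //=; last by rewrite mul0r addr0.
    by rewrite subrr normr0 mul0r.
  by rewrite scale0r subrr subr0 normr0 mul0r.
have fgY : annihilator Y (f + g - h).
  move=> u Yu; rewrite -[LHS]/(f u + g u - h u).
  apply/eqP; rewrite eq_le subr_le0 fg_le//=.
  have := fg_le (- u); rewrite !linearN -scaleN1r => /(_ (YZ _ _ Yu)).
  by lra.
have PY k : annihilator Y k -> P k = k by rewrite -rP => -[k' _ <-]; exact: PP.
have YP k u : Y u -> P k u = 0.
  by move=> Yu; have : annihilator Y (P k) by [rewrite -rP; exists k]; exact.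
(* [f + g - h] vanishes on [Y], so it is fixed by [P], while [P h = 0]. *)
have hE : h = (f - P f) + (g - P g).
  move: (PY _ fgY); rewrite linearB linearD Ph subr0 => Pfg.
  by rewrite addrACA -opprD Pfg opprB addrC subrK.
have : h x - g y <= `|f| * a + `|g| * b.
  have -> : h x - g y = (f - P f) x + (g - P g) (x - y).
    have gy : (g - P g) y = g y by rewrite -[LHS]/(g y - P g y) YP// subr0.
    have -> : (g - P g) (x - y) = (g - P g) x - g y.
      by rewrite -gy; exact: (linearB (g - P g : {linear X -> R^o})).
    by rewrite {1}hE; exact: esym (addrA _ _ _).
  apply: lerD.
    apply: le_trans (dual_bound _ xa) _.
    by rewrite ler_wpM2r// ltW.
  apply: le_trans (dual_bound _ xyb) _.
  by rewrite ler_wpM2r// ltW.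
by move: fg_norm kx; lra.
Qed.

End Approximation.

(** * Distances to slices *)

Section Distance.
Context {R : realType} (X : normedModType R).

Lemma dist_set_transfer (Z : normedModType R) (x : X) (z : Z) (A : set X)
    (B : set Z) (c : R) : A !=set0 ->
  (forall a, A a -> exists2 b, B b & `|z - b| <= `|x - a| + c) ->
  dist_set z B <= dist_set x A + c.
Proof.
move=> [a0 Aa0] AB; rewrite -lerBlDr; apply: lb_le_inf.
  by exists `|x - a0|, a0.
move=> _ [a /AB[b Bb zb] <-]; rewrite lerBlDr; apply: le_trans zb.
by apply: ge_inf; [exists 0 => _ [b' _ <-]|exists b].
Qed.

Lemma dist_opp_slice (f : dual X) (e : R) (y : X) :
  dist_set y (opp_slice f e) = dist_set (- y) (slice f e).
Proof.
congr inf; apply/seteqP; split=> r /=.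
  by move=> [_ [x Sx <-] <-]; exists x => //;
    rewrite -normrN opprD !opprK addrC.
move=> [x Sx <-]; exists (- x); first by exists x.
by rewrite -normrN opprD !opprK addrC.
Qed.

End Distance.

Section Subspace.
Context {R : realType} (X : completeNormedModType R) (Y : closedSubspace X).

Lemma restriction (h : dual X) :
  exists k : dual (cs_type Y), forall y, k y = h (cs_val y).
Proof.
pose k0 (y : cs_type Y) : R^o := h (cs_val y).
have k0lin : linear k0 by move=> a u v; exact: (linearP h).
pose k : {linear cs_type Y -> R^o} :=
  HB.pack k0 (GRing.isLinear.Build R (cs_type Y) R^o *:%R k0 k0lin).
apply: (@dual_of_bounded _ _ k `|h|) => y y1.
by rewrite (le_trans (le_dual_norm _ _))// ler_piMr// dual_norm_ge0.
Qed.

(** A point of [Y] provided by [subspace_approximation] for [x] in [A] has norm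
    at most [1 + t]; scaling it back into the unit ball moves it by at most [t]
    and divides its value under [h] by [1 + t]. *)
Lemma dist_subspace_slice (P : {linear dual X -> dual X}) (h : dual X)
    (k : dual (cs_type Y)) (A : set X) (B : set (cs_type Y)) (y : cs_type Y)
    (kappa t : R) :
  range P = annihilator (Y : set X) ->
  (forall f, P (P f) = P f) -> (forall f, `|f - P f| <= `|f|) -> P h = 0 ->
  (forall v, k v = h (cs_val v)) -> 0 < t -> `|y| = 1 -> A !=set0 ->
  (forall x, A x -> `|x| <= 1 /\ kappa < h x) ->
  (forall v : cs_type Y, `|v| <= 1 -> kappa / (1 + t) < k v -> B v) ->
  dist_set y B <= dist_set (cs_val y) A + 2 * t.
Proof.
move=> rP PP Pn Ph kh t0 y1 A0 Ah hB; apply: dist_set_transfer => // x Ax.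
have [x1 kx] := Ah _ Ax.
have t1 : 0 < 1 + t by lra.
have ny1 : `|cs_val y| = 1 := y1.
have [||||//|u [Yu ut uyt ku]] := @subspace_approximation _ _ Y P h x (cs_val y)
  (1 + t) (`|x - cs_val y| + t) kappa (cs_setP Y) rP PP Pn Ph (cs_valP y).
- by rewrite ny1; lra.
- by rewrite ltr_wpDl.
- by lra.
- by lra.
pose v := (1 + t)^-1 *: CsType (asboolT Yu : u \in cs_pred Y).
have vE : cs_val v = (1 + t)^-1 *: u by [].
exists v.
  apply: hB.
    by rewrite cs_normE vE normrZ normfV gtr0_norm// ler_pdivrMl// mulr1.
  by rewrite kh vE linearZ mulrC ltr_pM2l// invr_gt0.
rewrite cs_normE -[cs_val (y - v)]/(cs_val y - cs_val v) vE.
have -> : cs_val y - (1 + t)^-1 *: u =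
    (cs_val y - u) + (u - (1 + t)^-1 *: u) by rewrite addrA subrK.
apply: le_trans (ler_normD _ _) _.
have : `|u - (1 + t)^-1 *: u| <= t.
  rewrite -{1}[u]scale1r -scalerBl normrZ ger0_norm; last first.
    by rewrite subr_ge0 invf_le1//; lra.
  rewrite -ler_pdivlMl; last first.
    by rewrite subr_gt0 invf_lt1//; lra.
  apply: le_trans ut _; rewrite le_eqVlt; apply/orP; left; apply/eqP; field.
  by rewrite (addrC 1 t) addrK !gt_eqF// addrC.
rewrite distrC in uyt; rewrite [`|x - _|]distrC in uyt; lra.
Qed.

End Subspace.

(** * Heredity of the GL property *)

Theorem theorem2p3 (R : realType) (F : R^o * R^o -> R)
    (F_norm : abs_normalised_norm F)
    (F_extreme : extreme_point [set p | reversed_dual F p <= 1] (0, 1))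
    (X : completeNormedModType R) (X_GL : GL_space X)
    (Y : closedSubspace X) (Y_ideal : F_ideal F (Y : set X)) :
  GL_space (cs_type Y).
Proof.
have [_ [_ [P [[PP Pnorm] rP]]]] := Y_ideal.
have Pn g : `|g - P g| <= `|g|.
  by rewrite (Pnorm g); exact: ge_reversed_dual_snd.
move=> y0 y01 eps eps0.
have ny01 : `|cs_val y0| = 1 := y01.
have ny0le : `|cs_val y0| <= 1 by rewrite ny01.
(* With [e <= 1] the level [1 - e] is nonnegative, so that dividing the
   restriction of [h] by its norm, which is at most 1, does not decrease the
   values that matter. *)
pose e := Num.min eps 1.
have e0 : 0 < e by rewrite lt_min eps0 ltr01.
have e1 : e <= 1 by rewrite ge_min lexx orbT.
have eeps : e <= eps by rewrite ge_min lexx.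
have [|d d0 dP] := @extreme_small_fst _ F F_norm (e / 4) F_extreme.
  by lra.
pose delta := Num.min d (e / 4).
have delta0 : 0 < delta by rewrite lt_min d0; lra.
have deltad : delta <= d by rewrite ge_min lexx.
have deltae : delta <= e / 4 by rewrite ge_min lexx orbT.
have [f [f1 [_ fy0] fGL]] := X_GL _ ny01 _ delta0.
pose h := f - P f.
have Ph : P h = 0 by rewrite linearB PP subrr.
have hf v : (Y : set X) v -> h v = f v.
  move=> Yv; have : annihilator Y (P f) by rewrite -rP; exists f.
  by move=> /(_ v Yv) Pfv; rewrite -[h v]/(f v - P f v) Pfv subr0.
have h1 : `|h| <= 1 by rewrite (le_trans (Pn f))// f1.
have hy0 : 1 - delta < h (cs_val y0) by rewrite hf//; exact: cs_valP.
have hnorm : h (cs_val y0) <= `|h|.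
  by have := dual_bound h ny0le; rewrite mulr1.
have Pf_small : `|P f| < e / 4.
  apply: (dP _ `|h|); rewrite ?dual_norm_ge0 -?Pnorm ?f1//.
  by rewrite (lt_le_trans _ hnorm)//; lra.
have [k kh] := restriction Y h.
have kbeta : 1 - delta < `|k|.
  by have := @dual_bound _ _ k y0 1 ny0le; rewrite mulr1 kh; lra.
have k1 : `|k| <= 1.
  apply: dual_norm_le => y y1; rewrite kh (le_trans (le_dual_norm _ _))//.
  by rewrite mulr_ile1// dual_norm_ge0.
have beta0 : 0 < `|k| by lra.
(* [`|k|] lies between [1 - delta], by evaluation at [y0], and 1, so [z] is
   close to [k]. *)
pose z : dual (cs_type Y) := `|k|^-1 *: k.
have zE v : z v = `|k|^-1 * k v by [].
have k_le_z v : 0 <= k v -> k v <= z v.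
  by move=> kv; rewrite zE ler_peMl// invf_ge1.
have transfer (y : cs_type Y) : `|y| = 1 ->
    dist_set y (slice z eps) <= dist_set (cs_val y) (slice f delta) + e / 4.
  (* [h] exceeds [1 - delta - e / 4 >= 1 - e / 2] on the slice of [f]; the slack
     up to [1 - e] pays for the division by [1 + e / 8]. *)
  move=> y1; have -> : e / 4 = 2 * (e / 8) by field.
  apply: (@dist_subspace_slice _ _ _ P h k _ _ _ (1 - e / 2)) => //.
  - by lra.
  - by exists (cs_val y0); split=> //; rewrite ny01.
  - move=> x [x1 fx]; split=> //; rewrite -[h x]/(f x - P f x).
    by have := dual_bound (P f) x1; lra.
  - move=> v v1 kv; split=> //.
    have : 1 - e <= (1 - e / 2) / (1 + e / 8).
      by rewrite ler_pdivlMr; [nra|lra].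
    have := k_le_z v; lra.
exists z; split.
- by rewrite normrZ normfV normr_id mulVf// gt_eqF.
- split; first by rewrite y01.
  by have := k_le_z y0; rewrite kh; lra.
move=> y y1; rewrite dist_opp_slice.
have := fGL (cs_val y) y1; rewrite dist_opp_slice.
have := transfer y y1; have := transfer (- y).
rewrite normrN => /(_ y1); rewrite -[cs_val (- y)]/(- cs_val y).
by lra.
Qed.
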